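(* Let $X$, $Y$ be compact spaces and let $x_0\in X$, $y_0\in Y$ be non-isolated points in the corresponding spaces. Then the following conditions are equivalent: (i) there exist sequences $(U_n)_{n=1}^{\infty}$ and $(V_n)_{n=1}^{\infty}$ of nonempty functionally open sets $U_n\subseteq X$ and $V_n\subseteq Y$ which converge to $x_0$ and $y_0$ respectively, and such that $x_0\notin U_n$ and $y_0\notin V_n$ for every $n\in\mathbb N$; (ii) there exists a separately continuous function $f:X\times Y\to\mathbb R$ with $D(f)=\{(x_0,y_0)\}$.
   Context: Compact spaces are assumed to be Hausdorff. A set $A$ in a topological space $X$ is functionally open if there exists a continuous function $g:X\to[0,1]$ with $A=g^{-1}((0,1])$. A sequence $(A_n)_{n=1}^{\infty}$ of nonempty subsets of a topological space $X$ converges to a point $x_0\in X$ (written $A_n\to x_0$) if for every neighborhood $U$ of $x_0$ in $X$ there exists an integer $n_0$ such that $A_n\subseteq U$ for all $n\ge n_0$. A function $f:X\times Y\to\mathbb R$ is separately continuous if for every $x\in X$ the function $y\mapsto f(x,y)$ is continuous on $Y$ and for every $y\in Y$ the function $x\mapsto f(x,y)$ is continuous on $X$. $D(f)$ denotes the set of all points of discontinuity of $f$ (with respect to the product topology on $X\times Y$). *)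

(* Defs.v *)
From HB Require Import structures.
From mathcomp Require Import all_boot all_order all_algebra.
From mathcomp Require Import all_classical all_reals.
From mathcomp Require Import topology normedtype.
Set Implicit Arguments.
Unset Strict Implicit.
Unset Printing Implicit Defensive.

Import Order.TTheory GRing.Theory Num.Theory.
Import numFieldNormedType.Exports.

Local Open Scope classical_set_scope.
Local Open Scope ring_scope.

(* A function X -> [0, 1] is encoded as a real-valued function with values in
   [0, 1]. *)
Definition functionally_open (R : realType) (X : topologicalType)
    (A : set X) : Prop :=
  exists g : X -> R,
    [/\ continuous g, (forall x, g x \in `[0, 1]) & A = g @^-1` `]0, 1]].

Definition sets_converge (X : topologicalType) (A : nat -> set X) (x0 : X) :
    Prop :=
  forall U : set X, nbhs x0 U ->
    exists n0 : nat, forall n : nat, (n0 <= n)%N -> A n `<=` U.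

Definition separately_continuous (R : realType) (X Y : topologicalType)
    (f : X * Y -> R) : Prop :=
  (forall x : X, continuous (fun y : Y => f (x, y))) /\
  (forall y : Y, continuous (fun x : X => f (x, y))).

Definition discontinuity_set (R : realType) (Z : topologicalType)
    (f : Z -> R) : set Z :=
  [set z | ~ {for z, continuous f}].

(* Main.v *)
Require Import Defs.
From HB Require Import structures.
From mathcomp Require Import all_boot all_order all_algebra.
From mathcomp Require Import all_classical all_reals.
From mathcomp Require Import topology normedtype.
From mathcomp Require Import ring lra.
Set Implicit Arguments.
Unset Strict Implicit.
Unset Printing Implicit Defensive.

Import Order.TTheory GRing.Theory Num.Theory.
Import numFieldNormedType.Exports.

Local Open Scope classical_set_scope.
Local Open Scope ring_scope.

(** From sequences to a function: multiply bumps g_n supported on U_n by bumps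
    h_n supported on V_n, and put f(x, y) = sum_n g_n(x) h_n(y).  A point other
    than x0 has a neighborhood that meets only finitely many U_n, since X is
    Hausdorff and U_n converges to x0; likewise in Y.  So the sum is locally
    finite, hence continuous, off (x0, y0)
    ([continuous_sum_locally_finite]).  On the two axes {x0} x Y and X x {y0}
    every term vanishes, so f is separately continuous also at (x0, y0).
    Finally f >= 1 at the peaks of the products g_n h_n, which tend to
    (x0, y0), where f is 0: f is discontinuous there.

    From a function to sequences: adding to f a continuous function of the form
    u(x) + v(y), one may assume that f vanishes on the two axes.  Discontinuity
    at (x0, y0) gives e > 0 such that |f| > e at points arbitrarily close to
    (x0, y0).  Choose inductively functionally open rectangles U_n x V_n with
    |f| > e on U_n x V_n and |f| < e/2 on U_i x V_n for all i < n.  The second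
    condition can be met because f is continuous and 0 at (x_i, y0): shrinking
    U_i around x_i produces a neighborhood N of y0 with |f| < e/2 on U_i x N,
    and all later V_n are taken inside N ([large_rectangle_step]).

    Such rectangles converge to (x0, y0) ([large_rectangles_converge]).
    Otherwise some points (u_n, v_n) of infinitely many of them have, by
    compactness, a cluster point z different from (x0, y0).  Near z the
    function f varies by less than e/2; but a product neighborhood of z contains
    some (u_i, v_i) and (u_n, v_n) with i < n, hence also (u_i, v_n), whereas
    |f(u_i, v_i)| > e and |f(u_i, v_n)| < e/2. *)

(** * Continuity of sections and of locally finite sums *)

Lemma continuous_section_l (R : realType) (X Y : topologicalType)
    (f : X * Y -> R) (x : X) (y : Y) :
  {for (x, y), continuous f} -> {for y, continuous (fun t => f (x, t))}.
Proof.
move=> cf; apply: (@continuous_comp _ _ _ (fun t => (x, t)) f) => //.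
by apply: cvg_pair; [exact: cvg_cst|exact: cvg_id].
Qed.

Lemma continuous_section_r (R : realType) (X Y : topologicalType)
    (f : X * Y -> R) (x : X) (y : Y) :
  {for (x, y), continuous f} -> {for x, continuous (fun t => f (t, y))}.
Proof.
move=> cf; apply: (@continuous_comp _ _ _ (fun t => (t, y)) f) => //.
by apply: cvg_pair; [exact: cvg_id|exact: cvg_cst].
Qed.

Lemma lim_sum_eventually0 (R : realType) (u : nat -> R) (N : nat) :
  (forall n, (N <= n)%N -> u n = 0) ->
  lim ((\sum_(i < n) u i) @[n --> \oo]) = \sum_(i < N) u i.
Proof.
move=> u0; apply: lim_near_cst => //; exists N => // n /= Nn.
rewrite -(subnKC Nn) big_split_ord /= [X in _ + X]big1 ?addr0// => i _.
by rewrite u0// leq_addr.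
Qed.

Lemma continuous_sum_locally_finite (R : realType) (Z : topologicalType)
    (F : nat -> Z -> R) (z : Z) (N : nat) :
  (forall n, {for z, continuous (F n)}) ->
  (\forall w \near z, forall n, (N <= n)%N -> F n w = 0) ->
  {for z, continuous (fun w => lim ((\sum_(i < n) F i w) @[n --> \oo]))}.
Proof.
move=> cF F0.
have cS : {for z, continuous (fun w => \sum_(i < N) F i w)}.
  by apply: cvg_big => [|i _]; [exact: add_continuous|exact: cF].
rewrite /prop_for/continuous_at (lim_sum_eventually0 (nbhs_singleton F0)).
apply: cvg_trans cS; apply: near_eq_cvg; near=> w.
have F0w : forall n, (N <= n)%N -> F n w = 0 by near: w; exact: F0.
by rewrite (lim_sum_eventually0 F0w).
Unshelve. all: by end_near. Qed.

(** * A separately continuous function built from the sequences *)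

Lemma functionally_open_bump (R : realType) (X : topologicalType) (U : set X)
    (x : X) :
  functionally_open R U -> U x ->
  exists g : X -> R, [/\ continuous g, forall t, 0 <= g t, g x = 1 &
    forall t, ~ U t -> g t = 0].
Proof.
move=> [g [cg g01 ->]] /=; rewrite in_itv/= => /andP[gx0 _].
exists (fun t => g t / g x); split.
- by move=> t; apply: cvgMl; exact: cg.
- move=> t; rewrite divr_ge0 ?(ltW gx0)//.
  by have := g01 t; rewrite in_itv/= => /andP[].
- by rewrite divff ?gt_eqF.
- move=> t /=; rewrite in_itv/= => /negP; have := g01 t; rewrite in_itv/=.
  move=> /andP[gt0 ->]; rewrite andbT -leNgt => gt0'.
  by rewrite (le_anti (introT andP (conj gt0' gt0))) mul0r.
Qed.

(** Away from its limit a convergent sequence of sets is locally finite: this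
    makes the sum of bumps continuous off (x0, y0). *)
Lemma sets_converge_locally_finite (X : topologicalType) (U : nat -> set X)
    (x0 x : X) :
  hausdorff_space X -> sets_converge U x0 -> x <> x0 ->
  exists N, \forall t \near x, forall n, (N <= n)%N -> ~ U n t.
Proof.
rewrite open_hausdorff => hX Ux0 /eqP xx0.
have [[A B] /= [xA x0B] [oA oB /eqP AB0]] := hX _ _ xx0.
have [|N UB] := Ux0 B.
  by apply: open_nbhs_nbhs; split=> //; exact: set_mem.
exists N; apply: (@filterS _ _ _ A); last first.
  by apply: open_nbhs_nbhs; split=> //; exact: set_mem.
move=> t At n Nn Unt; suff : set0 t by [].
by rewrite -AB0; split=> //; exact: (UB n).
Qed.

Lemma separately_continuous_of_sequences (R : realType) (X Y : topologicalType)
    (x0 : X) (y0 : Y) (U : nat -> set X) (V : nat -> set Y) :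
  hausdorff_space X -> hausdorff_space Y ->
  (forall n, [/\ U n !=set0, functionally_open R (U n) & ~ U n x0]) ->
  (forall n, [/\ V n !=set0, functionally_open R (V n) & ~ V n y0]) ->
  sets_converge U x0 -> sets_converge V y0 ->
  exists f : X * Y -> R,
    separately_continuous f /\ discontinuity_set f = [set (x0, y0)].
Proof.
move=> hX hY HU HV Ux0 Vy0.
have /choice[ag Hg] : forall n, exists ag : X * (X -> R), [/\ U n ag.1,
    continuous ag.2, forall t, 0 <= ag.2 t, ag.2 ag.1 = 1 &
    forall t, ~ U n t -> ag.2 t = 0].
  move=> n; have [[a Ua] fU _] := HU n.
  by have [g [? ? ? ?]] := functionally_open_bump fU Ua; exists (a, g).
have /choice[bh Hh] : forall n, exists bh : Y * (Y -> R), [/\ V n bh.1,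
    continuous bh.2, forall t, 0 <= bh.2 t, bh.2 bh.1 = 1 &
    forall t, ~ V n t -> bh.2 t = 0].
  move=> n; have [[b Vb] fV _] := HV n.
  by have [h [? ? ? ?]] := functionally_open_bump fV Vb; exists (b, h).
pose F n (z : X * Y) := (ag n).2 z.1 * (bh n).2 z.2.
pose f z := lim ((\sum_(i < n) F i z) @[n --> \oo]).
have FU0 n z : ~ U n z.1 -> F n z = 0.
  by move=> Uz; rewrite /F; have [_ _ _ _ ->] := Hg n; rewrite ?mul0r.
have FV0 n z : ~ V n z.2 -> F n z = 0.
  by move=> Vz; rewrite /F; have [_ _ _ _ ->] := Hh n; rewrite ?mulr0.
have Fx0 n y : F n (x0, y) = 0 by apply: FU0; case: (HU n).
have Fy0 n x : F n (x, y0) = 0 by apply: FV0; case: (HV n).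
have f0 z : (forall n, F n z = 0) -> f z = 0.
  by move=> F0; rewrite /f (@lim_sum_eventually0 _ (F^~ z) 0) ?big_ord0.
have fx0 y : f (x0, y) = 0 by apply: f0.
have fy0 x : f (x, y0) = 0 by apply: f0.
have finF z : z <> (x0, y0) ->
    exists N, \forall w \near z, forall n, (N <= n)%N -> F n w = 0.
  case: z => x y zxy; have [xx0|xx0] := pselect (x = x0).
    have yy0 : y <> y0 by move=> yy0; apply: zxy; rewrite xx0 yy0.
    have [N HN] := sets_converge_locally_finite hY Vy0 yy0.
    exists N; suff : \forall w \near (x, y), forall n, (N <= n)%N -> ~ V n w.2.
      by apply: filterS => w Vw n /Vw; exact: FV0.
    exact: (@cvg_snd _ _ (nbhs x) (nbhs y) _ _ HN).
  have [N HN] := sets_converge_locally_finite hX Ux0 xx0.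
  exists N; suff : \forall w \near (x, y), forall n, (N <= n)%N -> ~ U n w.1.
    by apply: filterS => w Uw n /Uw; exact: FU0.
  exact: (@cvg_fst _ _ (nbhs x) (nbhs y) _ _ HN).
have cF n : continuous (F n).
  move=> z; apply: cvgM.
    apply: (@continuous_comp _ _ _ fst); first exact: cvg_fst.
    by case: (Hg n) => _ + _ _ _; exact.
  apply: (@continuous_comp _ _ _ snd); first exact: cvg_snd.
  by case: (Hh n) => _ + _ _ _; exact.
have cf z : z <> (x0, y0) -> {for z, continuous f}.
  move=> /finF[N FN]; apply: (@continuous_sum_locally_finite _ _ _ _ N) => //.
  by move=> n; exact: cF.
(* Only the sections along the two axes pass through (x0, y0), and these are
   constant; elsewhere joint continuity applies. *)
exists f; split; first split.
- move=> x y; have [->|xx0] := pselect (x = x0).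
    by under eq_fun do rewrite fx0; exact: cst_continuous.
  by apply: continuous_section_l; apply: cf => -[].
- move=> y x; have [->|yy0] := pselect (y = y0).
    by under eq_fun do rewrite fy0; exact: cst_continuous.
  by apply: continuous_section_r; apply: cf => -[].
apply/seteqP; split=> z /=.
  by apply: contra_notP => /cf.
move=> -> cf0.
have [[A B] /= [/Ux0[m UA] /Vy0[n VB]] AB] :
    nbhs (x0, y0) [set z | `|f (x0, y0) - f z| < 1].
  by apply: (cvgr_dist_lt _ _ cf0).
(* A and B contain all U_i with i >= m and all V_i with i >= n, so the peak of
   the k-th term lies in A x B for k the larger of m and n. *)
pose k := maxn m n.
have [Uk _ g0 g1 gU] := Hg k; have [Vk _ h0 h1 hV] := Hh k.
have : (A `*` B) ((ag k).1, (bh k).1).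
  by split=> /=; [apply: (UA k)|apply: (VB k)]; rewrite ?leq_maxl ?leq_maxr.
move=> /AB /=; rewrite fx0 sub0r normrN ltNge => /negP; apply.
rewrite (le_trans _ (ler_norm _))//.
have [|N /nbhs_singleton FN] := finF ((ag k).1, (bh k).1).
  by move=> [e _]; case: (HU k) => _ _; rewrite -e.
(* At the peak the sum has finitely many nonzero terms; the cut-off is taken
   beyond k so that the k-th term, equal to 1, is among those kept. *)
rewrite /f (@lim_sum_eventually0 _ (F^~ _) (maxn N k.+1)); last first.
  by move=> i; rewrite geq_max => /andP[Ni _]; exact: FN.
have kN : (k < maxn N k.+1)%N by rewrite leq_maxr.
rewrite (bigD1 (Ordinal kN))//= {1}/F/= g1 h1 mulr1 lerDl.
apply: sumr_ge0 => i _; apply: mulr_ge0.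
  by case: (Hg i) => _ _ + _ _; exact.
by case: (Hh i) => _ _ + _ _; exact.
Qed.

(** * Sequences obtained from a separately continuous function *)

(** Urysohn's lemma: functionally open sets form a base of a compact Hausdorff
    space. *)
Lemma functionally_open_nbhs (R : realType) (X : topologicalType) (x : X)
    (A : set X) :
  hausdorff_space X -> compact [set: X] -> nbhs x A ->
  exists U : set X, [/\ functionally_open R U, U x & U `<=` A].
Proof.
move=> hX cX xA.
have sep : uniform_separator (~` A^°) [set x].
  apply: normal_uniform_separator.
  - exact: compact_normal.
  - exact: open_closedC (open_interior A).
  - exact: accessible_closed_set1 (hausdorff_accessible hX) _.
  - by apply/disjoints_subset => t nA tx; apply: nA; rewrite tx.
have /(uniform_separatorP (R := R))[g [cg g01 g0 g1]] := sep.
exists (g @^-1` `]0, 1]); split.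
- by exists g; split=> // t; apply: g01; exists t.
- have -> : (g @^-1` `]0, 1]) x = (g x \in `]0, 1]) by [].
  by rewrite (g1 (g x)) ?in_itv/= ?ltr01 ?lexx//; exists x.
- move=> t /=; rewrite in_itv/= => /andP[gt0 _]; apply: interior_subset.
  apply: contrapT => nA; suff gt : g t = 0 by move: gt0; rewrite gt ltxx.
  by apply: g0; exists t.
Qed.

(** The two sections of f through (x0, y0) are subtracted; the constant
    f (x0, y0), subtracted twice, is added back, so the result vanishes on
    {x0} x Y and on X x {y0}. *)
Definition normalize_axes (R : realType) (X Y : Type) (f : X * Y -> R)
    (x0 : X) (y0 : Y) (z : X * Y) : R :=
  f z - f (x0, z.2) - f (z.1, y0) + f (x0, y0).

Lemma separately_continuous_correction (R : realType) (X Y : topologicalType)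
    (f : X * Y -> R) (x0 : X) (y0 : Y) :
  separately_continuous f ->
  continuous (fun z : X * Y => f (x0, z.2) + f (z.1, y0) - f (x0, y0)).
Proof.
move=> [fl fr] z; apply: cvgB; last exact: cvg_cst.
apply: cvgD.
  apply: (@continuous_comp _ _ _ snd (fun y => f (x0, y))); last exact: fl.
  exact: cvg_snd.
apply: (@continuous_comp _ _ _ fst (fun x => f (x, y0))); last exact: fr.
exact: cvg_fst.
Qed.

(** The function and its normalization differ by a sum of functions of one
    variable, which is jointly continuous. *)
Lemma discontinuity_set_normalize (R : realType) (X Y : topologicalType)
    (f : X * Y -> R) (x0 : X) (y0 : Y) :
  separately_continuous f ->
  discontinuity_set (normalize_axes f x0 y0) = discontinuity_set f.
Proof.
move=> scf.
have cc := separately_continuous_correction (x0 := x0) (y0 := y0) scf.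
apply/seteqP; split=> z /=; apply: contra_not => cz.
  have -> : normalize_axes f x0 y0 =
      f \- (fun z => f (x0, z.2) + f (z.1, y0) - f (x0, y0)).
    by apply/funext => w; rewrite /normalize_axes/=; ring.
  by apply: cvgB; [exact: cz|exact: cc].
have -> : f = normalize_axes f x0 y0 \+
      (fun z => f (x0, z.2) + f (z.1, y0) - f (x0, y0)).
  by apply/funext => w; rewrite /normalize_axes/=; ring.
by apply: cvgD; [exact: cz|exact: cc].
Qed.

(** One step of the induction.  The neighborhood [N] of [y0] records the
    conditions imposed by the earlier rectangles.  In the triple [r], the first
    two sets are the sides of the new rectangle, and the third is the
    neighborhood of [y0] handed to the next step.  A single [U] serves both
    purposes: it is chosen small around a point [x] of a large value, for
    continuity at [(x, y)] and for continuity at [(x, y0)], where [f] is 0. *)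
Lemma large_rectangle_step (R : realType) (X Y : topologicalType)
    (f : X * Y -> R) (x0 : X) (y0 : Y) (e : R) (N : set Y) :
  hausdorff_space X -> compact [set: X] ->
  hausdorff_space Y -> compact [set: Y] ->
  0 < e -> (forall y, f (x0, y) = 0) -> (forall x, f (x, y0) = 0) ->
  (forall z, z <> (x0, y0) -> {for z, continuous f}) ->
  (forall W, nbhs (x0, y0) W -> exists2 z, W z & e < `|f z|) ->
  nbhs y0 N ->
  exists r : set X * set Y * set Y,
    [/\ r.1.1 !=set0 /\ functionally_open R r.1.1,
        r.1.2 !=set0 /\ functionally_open R r.1.2,
        (forall x y, r.1.1 x -> r.1.2 y -> e < `|f (x, y)|),
        r.1.2 `<=` N &
        [/\ nbhs y0 r.2, r.2 `<=` N &
          forall x y, r.1.1 x -> r.2 y -> `|f (x, y)| < e / 2]].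
Proof.
move=> hX cX hY cY e0 fx0 fy0 cf big Ny0.
have [|[x y] /= Ny fxy] := big (snd @^-1` N^°).
  by apply: (@cvg_snd _ _ (nbhs x0) (nbhs y0)); rewrite nbhs_simpl;
    exact: nbhs_interior.
have xx0 : x <> x0.
  by move=> xx0; move: fxy; rewrite xx0 fx0 normr0 ltNge ltW.
have nf : {for (x, y), continuous (fun z => `|f z|)}.
  by apply: cvg_norm; apply: cf => -[].
have nf0 : {for (x, y0), continuous (fun z => `|f z|)}.
  by apply: cvg_norm; apply: cf => -[].
have [[A B] /= [Ax By] AB] : nbhs (x, y) [set z | e < `|f z|].
  exact: (cvgr_gt _ nf).
have [[A' N'] /= [A'x N'y0] AN'] : nbhs (x, y0) [set z | `|f z| < e / 2].
  by apply: (cvgr_lt _ nf0); rewrite fy0 normr0 divr_gt0.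
have [U [fU Ux UA]] := functionally_open_nbhs R hX cX (filterI Ax A'x).
have [V [fV Vy VB]] := functionally_open_nbhs R hY cY (filterI By Ny).
exists (U, V, N `&` N'); split=> /=.
- by split=> //; exists x.
- by split=> //; exists y.
- by move=> s t /UA[As _] /VB[Bt _]; exact: (AB (s, t)).
- by move=> t /VB[].
- split; [exact: filterI|by move=> t []|].
  by move=> s t /UA[_ A's] [_ N't]; exact: (AN' (s, t)).
Qed.

(** The off-diagonal bound, for [i < n], forces convergence: around a cluster point other than [z0] one finds a diagonal
    point of rectangle [i], with [|f| > e], and an off-diagonal point of
    [U i `*` V n], with [|f| < e / 2], although [f] is nearly constant there. *)
Lemma large_rectangles_converge (R : realType) (X Y : topologicalType)
    (f : X * Y -> R) (z0 : X * Y) (e : R)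
    (U : nat -> set X) (V : nat -> set Y) :
  compact [set: X] -> compact [set: Y] -> 0 < e ->
  (forall z, z <> z0 -> {for z, continuous f}) ->
  (forall n x y, U n x -> V n y -> e < `|f (x, y)|) ->
  (forall i n x y, (i < n)%N -> U i x -> V n y -> `|f (x, y)| < e / 2) ->
  sets_converge (fun n => U n `*` V n) z0.
Proof.
move=> cX cY e0 cf large small O z0O; apply: contrapT => H.
have /choice[p Hp] : forall n, exists p : nat * (X * Y),
    [/\ (n <= p.1)%N, U p.1 p.2.1, V p.1 p.2.2 & ~ O p.2].
  move=> n; apply: contrapT => Hn; apply: H; exists n => m nm z [Uz Vz].
  by apply: contrapT => nOz; apply: Hn; exists (m, z).
have cXY : compact [set: X * Y] by rewrite -setXTT; exact: compact_setX.
have [z [_ clz]] := cXY ((fun n => (p n).2) @ \oo) _ filterT.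
have hit W m : nbhs z W -> exists2 n, (m <= n)%N & W (p n).2.
  move=> zW; have [|_ [[n mn <-] Wn]] :=
    clz [set (p n).2 | n in [set n | (m <= n)%N]] W _ zW.
    by exists m => // n mn; exists n.
  by exists n.
have zz0 : z <> z0.
  move=> zz0; have [|n _] := hit O 0%N; first by rewrite zz0.
  by case: (Hp n).
have [[A B] /= [Az Bz] AB] : nbhs z [set w | `|f z - f w| < e / 4].
  by apply: (cvgr_dist_lt _ _ (cf _ zz0)); rewrite divr_gt0.
have zAB : nbhs z (A `*` B) by exists (A, B).
have [n _ [An Bn]] := hit _ 0%N zAB.
(* The k-th point is sought beyond index (p n).1, so that its rectangle comes
   strictly after the one that contains the n-th point. *)
have [k nk [Ak Bk]] := hit _ (p n).1.+1 zAB.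
have [_ Un Vn _] := Hp n; have [pk Uk Vk _] := Hp k.
have := small _ _ _ _ (leq_trans nk pk) Un Vk.
have := large _ _ _ Un Vn.
have := AB ((p n).2.1, (p n).2.2) (conj An Bn).
have := AB ((p n).2.1, (p k).2.2) (conj An Bk).
rewrite /= !ltr_norml ltr_normr => /andP[? ?] /andP[? ?] /orP[?|?] /andP[? ?];
  lra.
Qed.

Lemma sequences_of_separately_continuous (R : realType)
    (X Y : topologicalType) (f : X * Y -> R) (x0 : X) (y0 : Y) :
  hausdorff_space X -> compact [set: X] ->
  hausdorff_space Y -> compact [set: Y] ->
  (forall y, f (x0, y) = 0) -> (forall x, f (x, y0) = 0) ->
  discontinuity_set f = [set (x0, y0)] ->
  exists (U : nat -> set X) (V : nat -> set Y),
    (forall n, [/\ U n !=set0, functionally_open R (U n) & ~ U n x0]) /\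
    (forall n, [/\ V n !=set0, functionally_open R (V n) & ~ V n y0]) /\
    sets_converge U x0 /\ sets_converge V y0.
Proof.
move=> hX cX hY cY fx0 fy0 Df.
have cf z : z <> (x0, y0) -> {for z, continuous f}.
  move=> zz0; apply: contrapT => ncf; apply: zz0.
  by have : discontinuity_set f z by []; rewrite Df.
have ncf : ~ {for (x0, y0), continuous f}.
  by have : [set (x0, y0)] (x0, y0) by []; rewrite -Df.
have [e e0 big] : exists2 e, 0 < e &
    forall W, nbhs (x0, y0) W -> exists2 z, W z & e < `|f z|.
  apply: contrapT => nbig; apply: ncf; apply/cvgrPdist_le => e e0.
  apply: contrapT => ne; apply: nbig; exists e => // W z0W.
  apply: contrapT => nW; apply: ne; apply: filterS z0W => z Wz.
  rewrite fx0 sub0r normrN leNgt; apply/negP => ez; apply: nW.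
  by exists z.
pose P N (r : set X * set Y * set Y) := nbhs y0 N ->
  [/\ r.1.1 !=set0 /\ functionally_open R r.1.1,
      r.1.2 !=set0 /\ functionally_open R r.1.2,
      (forall x y, r.1.1 x -> r.1.2 y -> e < `|f (x, y)|),
      r.1.2 `<=` N &
      [/\ nbhs y0 r.2, r.2 `<=` N &
        forall x y, r.1.1 x -> r.2 y -> `|f (x, y)| < e / 2]].
have /choice[s Hs] : forall N, exists r, P N r.
  move=> N; have [Ny0|nN] := pselect (nbhs y0 N); last first.
    by exists (set0, set0, set0) => /nN.
  have [r Hr] := large_rectangle_step hX cX hY cY e0 fx0 fy0 cf big Ny0.
  by exists r.
(* N n lies in the neighborhoods of y0 attached to all rectangles of index less
   than n; no rectangle precedes the first, so N 0 is the whole space. *)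
pose N n := iter n (fun M => (s M).2) setT.
have Ny0 n : nbhs y0 (N n).
  by elim: n => [|n /Hs[_ _ _ _ []]]; first exact: filterT.
have NS n : N n.+1 `<=` N n by have [_ _ _ _ []] := Hs _ (Ny0 n).
have Nle i n : (i <= n)%N -> N n `<=` N i.
  move=> /subnK <-; elim: (n - i)%N => // k IH; exact: subset_trans (NS _) IH.
pose U n := (s (N n)).1.1; pose V n := (s (N n)).1.2.
have large n x y : U n x -> V n y -> e < `|f (x, y)|.
  by have [_ _ + _ _] := Hs _ (Ny0 n); exact.
have small i n x y : (i < n)%N -> U i x -> V n y -> `|f (x, y)| < e / 2.
  move=> lt_in Ux Vy; have [_ _ _ _ [_ _ sm]] := Hs _ (Ny0 i).
  apply: sm => //; apply: (Nle i.+1 n) => //.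
  by have [_ _ _ VN _] := Hs _ (Ny0 n); exact: VN.
have UV0 := large_rectangles_converge cX cY e0 cf large small.
have U0 n : U n !=set0 by have [[]] := Hs _ (Ny0 n).
have V0 n : V n !=set0 by have [_ []] := Hs _ (Ny0 n).
exists U, V; split; [|split; [|split]].
- move=> n; split=> //; first by have [[]] := Hs _ (Ny0 n).
  have [y Vy] := V0 n => /large/(_ Vy).
  by rewrite fx0 normr0 ltNge ltW.
- move=> n; split=> //; first by have [_ []] := Hs _ (Ny0 n).
  have [x Ux] := U0 n => /(large _ _ _ Ux).
  by rewrite fy0 normr0 ltNge ltW.
- move=> O Ox0; have [|m Hm] := UV0 (fst @^-1` O).
    exact: (@cvg_fst _ _ (nbhs x0) (nbhs y0)).
  exists m => n mn x Ux; have [y Vy] := V0 n.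
  exact: (Hm n mn (x, y)).
- move=> O Oy0; have [|m Hm] := UV0 (snd @^-1` O).
    exact: (@cvg_snd _ _ (nbhs x0) (nbhs y0)).
  exists m => n mn y Vy; have [x Ux] := U0 n.
  exact: (Hm n mn (x, y)).
Qed.

(** * The equivalence *)

Theorem theorem5p1 (R : realType) (X Y : topologicalType)
    (hausdorffX : hausdorff_space X) (compactX : compact [set: X])
    (hausdorffY : hausdorff_space Y) (compactY : compact [set: Y])
    (x0 : X) (y0 : Y)
    (x0_non_isolated : ~ isolated [set: X] x0)
    (y0_non_isolated : ~ isolated [set: Y] y0) :
  (exists (U : nat -> set X) (V : nat -> set Y),
      (forall n : nat,
          [/\ U n !=set0, functionally_open R (U n) & ~ U n x0]) /\
      (forall n : nat,
          [/\ V n !=set0, functionally_open R (V n) & ~ V n y0]) /\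
      sets_converge U x0 /\ sets_converge V y0)
  <->
  (exists f : X * Y -> R,
      separately_continuous f /\ discontinuity_set f = [set (x0, y0)]).
Proof.
split=> [[U [V [HU [HV [Ux0 Vy0]]]]]|[f [scf Df]]].
  exact: (separately_continuous_of_sequences hausdorffX hausdorffY HU HV).
have Dg : discontinuity_set (normalize_axes f x0 y0) = [set (x0, y0)].
  by rewrite discontinuity_set_normalize.
apply: (sequences_of_separately_continuous _ _ _ _ _ _ Dg) => //.
  by move=> y; rewrite /normalize_axes/=; ring.
by move=> x; rewrite /normalize_axes/=; ring.
Qed.
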